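(* Let $\mathbf{M}\in\mathbb{R}^{n\times n}$ be the normalized hypergraph Laplacian matrix of an admissible hypergraph with $n$ nodes, and let $K\in\mathbb{N}$. For every $K$-order polynomial filter function $p(\mathbf{X}):=\left(\sum_{k=0}^K\theta_k\mathbf{M}^k\right)\mathbf{X}$ with arbitrary coefficients $\theta_0,\dots,\theta_K\in\mathbb{R}$ and input feature matrix $\mathbf{X}\in\mathbb{R}^{n\times d}$, there exists an IHGNN on this hypergraph with identity activation $\phi(x)=x$ that expresses it, i.e. whose output on input $\mathbf{X}$ is $\widehat{\mathbf{Y}}=p(\mathbf{X})$.
   Context: A weighted hypergraph $G=(V,E,\mathbf{w})$ has nodes $V=\{v_1,\dots,v_n\}$, hyperedges $E=\{e_1,\dots,e_m\}$ (each a nonempty subset of $V$), and a hyperedge-weight vector $\mathbf{w}=(w_1,\dots,w_m)^\top\in\mathbb{R}^m$. Its incidence matrix $\mathbf{H}\in\{0,1\}^{n\times m}$ has $\mathbf{H}_{i,j}=1$ if $v_i\in e_j$ and $0$ otherwise. Let $\mathbf{E}=\mathrm{Diag}(\mathbf{w})\in\mathbb{R}^{m\times m}$; let $\mathbf{D}\in\mathbb{R}^{n\times n}$ be the diagonal node degree matrix with $\mathbf{D}_{i,i}=\sum_{j=1}^m\mathbf{H}_{i,j}w_j$; let $\mathbf{B}\in\mathbb{R}^{m\times m}$ be the diagonal hyperedge degree matrix with $\mathbf{B}_{j,j}=\sum_{i=1}^n\mathbf{H}_{i,j}$. The hypergraph is admissible if every hyperedge weight is nonnegative and every node has positive degree.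 The normalized hypergraph Laplacian matrix is $\mathbf{M}:=\mathbf{D}^{-1/2}\mathbf{H}\mathbf{E}\mathbf{B}^{-1}\mathbf{H}^\top\mathbf{D}^{-1/2}$. An IHGNN on the hypergraph, with activation $\phi:\mathbb{R}\to\mathbb{R}$ (applied entrywise), hidden dimension $d_h$, output dimension $d'$, and weights $\mathbf{W}\in\mathbb{R}^{d_h\times d_h}$, $\boldsymbol{\Theta}_1\in\mathbb{R}^{d\times d_h}$, $\boldsymbol{\Theta}_2\in\mathbb{R}^{d_h\times d'}$, $\mathbf{b}\in\mathbb{R}^{d_h}$, is the map sending $\mathbf{X}\in\mathbb{R}^{n\times d}$ to $\widehat{\mathbf{Y}}=\mathbf{Z}\boldsymbol{\Theta}_2\in\mathbb{R}^{n\times d'}$, where $\mathbf{Z}\in\mathbb{R}^{n\times d_h}$ is the solution of $\mathbf{Z}=\phi(\mathbf{M}\mathbf{Z}\mathbf{W}+\mathbf{X}\boldsymbol{\Theta}_1+\mathbf{1}_n\mathbf{b}^\top)$; the map is well defined when this equation has a unique solution. The dimensions $d_h,d'$ and all weights may be chosen freely. *)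

(* Defs.v *)
From HB Require Import structures.
From mathcomp Require Import all_boot all_order all_algebra.
From mathcomp Require Import reals.

Set Implicit Arguments.
Unset Strict Implicit.
Unset Printing Implicit Defensive.

Import Order.TTheory GRing.Theory Num.Theory.

Local Open Scope ring_scope.

(* Nodes are 'I_n.  Hyperedges form an indexed family, so two indices may
   carry the same node set; a set {e_1, ..., e_m} of distinct hyperedges is
   the special case of an injective family. *)
Record hypergraph (R : realType) (n m : nat) := Hypergraph {
  hyperedge : 'I_m -> {set 'I_n};
  weight : 'cV[R]_m;
  hyperedge_nonempty : forall j, hyperedge j != set0
}.

Section Laplacian.
Variables (R : realType) (n m : nat) (G : hypergraph R n m).

Definition incidence_mx : 'M[R]_(n, m) :=
  \matrix_(i, j) (i \in hyperedge G j)%:R.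

Definition node_degree (i : 'I_n) : R :=
  \sum_(j < m) incidence_mx i j * weight G j 0.

Definition hyperedge_degree (j : 'I_m) : R := \sum_(i < n) incidence_mx i j.

Definition weight_mx : 'M[R]_m := diag_mx (weight G)^T.

Definition hyperedge_degree_mx : 'M[R]_m := diag_mx (\row_j hyperedge_degree j).

(* D^{-1/2}, meaningful when all node degrees are positive *)
Definition node_degree_invsqrt_mx : 'M[R]_n :=
  diag_mx (\row_i (Num.sqrt (node_degree i))^-1).

Definition normalized_laplacian : 'M[R]_n :=
  node_degree_invsqrt_mx *m incidence_mx *m weight_mx
  *m invmx hyperedge_degree_mx *m incidence_mx^T *m node_degree_invsqrt_mx.

Definition admissible : Prop :=
  (forall j, 0 <= weight G j 0) /\ (forall i, 0 < node_degree i).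

End Laplacian.

Record ihgnn (R : realType) (d d' : nat) := IHGNN {
  activation : R -> R;
  hidden_dim : nat;
  hidden_dim_gt0 : (0 < hidden_dim)%N;
  W : 'M[R]_hidden_dim;
  Theta1 : 'M[R]_(d, hidden_dim);
  Theta2 : 'M[R]_(hidden_dim, d');
  bias : 'cV[R]_hidden_dim
}.

Section Ihgnn.
Variables (R : realType) (n m d d' : nat).
Variables (G : hypergraph R n m) (N : ihgnn R d d').

Definition ihgnn_equilibrium (X : 'M[R]_(n, d)) (Z : 'M[R]_(n, hidden_dim N)) :
    Prop :=
  Z = map_mx (activation N)
        (normalized_laplacian G *m Z *m W N + X *m Theta1 N
         + (const_mx 1 : 'cV[R]_n) *m (bias N)^T).

(* The output on X exists only if the equilibrium equation has exactly one
   solution. *)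
Definition ihgnn_output (X : 'M[R]_(n, d)) (Y : 'M[R]_(n, d')) : Prop :=
  exists Z, unique (ihgnn_equilibrium X) Z /\ Y = Z *m Theta2 N.

(* The weights of N do not depend on the input X. *)
Definition ihgnn_expresses (f : 'M[R]_(n, d) -> 'M[R]_(n, d')) : Prop :=
  forall X, ihgnn_output X (f X).

End Ihgnn.

Definition polynomial_filter (R : realType) (n d K : nat) (M : 'M[R]_n)
    (theta : 'I_K.+1 -> R) (X : 'M[R]_(n, d)) : 'M[R]_(n, d) :=
  (\sum_(k < K.+1) theta k *: M ^+ k) *m X.

(* Main.v *)
Require Import Defs.
From HB Require Import structures.
From mathcomp Require Import all_boot all_order all_algebra.
From mathcomp Require Import reals.

Set Implicit Arguments.
Unset Strict Implicit.
Unset Printing Implicit Defensive.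

Import Order.TTheory GRing.Theory Num.Theory.

Local Open Scope ring_scope.

(* If W is nilpotent, say W^r = 0, then Z = M Z W + C has the unique solution
   Z = \sum_(k < r) M^k C W^k, whatever M is.  With zero bias, the network
   therefore outputs \sum_(k < r) M^k X (Theta1 W^k Theta2), and it suffices to
   have W^(K+1) = 0 and Theta1 W^k Theta2 = theta_k I_d for all k <= K.  Take K+1
   blocks of hidden units: Theta1 embeds the input in block 0, W shifts each
   block to the next one, and Theta2 reads block k with coefficient theta_k. *)

Section SteinEquation.
Variables (R : comPzRingType) (n h : nat).
Implicit Types (A : 'M[R]_n) (B : 'M[R]_h) (C Z : 'M[R]_(n, h)).

(** Substituting the equation for [Z] in the leading term splits off the summand of index [r]. *)
Lemma stein_iter A B C Z (r : nat) : Z = A *m Z *m B + C ->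
  Z = A ^+ r *m Z *m B ^+ r + \sum_(k < r) A ^+ k *m C *m B ^+ k.
Proof.
move=> eqZ; elim: r => [|r IHr].
  by rewrite big_ord0 !expr0 mul1mx mulmx1 addr0.
rewrite big_ord_recr /= [_ + _ *m _]addrC addrA {1}IHr; congr (_ + _).
by rewrite {1}eqZ mulmxDr mulmxDl exprSr exprS -!mulmxE !mulmxA.
Qed.

Lemma stein_nilpotent A B C Z (r : nat) : B ^+ r = 0 ->
  Z = A *m Z *m B + C <-> Z = \sum_(k < r) A ^+ k *m C *m B ^+ k.
Proof.
move=> Br0; split=> [/(stein_iter r) | ->]; first by rewrite Br0 mulmx0 add0r.
rewrite mulmx_sumr mulmx_suml.
(* In the sum with one more term, the last term vanishes by nilpotency and the first is [C]. *)
transitivity (\sum_(k < r.+1) A ^+ k *m C *m B ^+ k).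
  by rewrite big_ord_recr /= Br0 mulmx0 addr0.
rewrite big_ord_recl !expr0 mul1mx mulmx1 addrC; congr (_ + _).
apply: eq_bigr => k _.
by rewrite lift0 exprS exprSr -!mulmxE !mulmxA.
Qed.

End SteinEquation.

(** The index is compared in [nat], not modulo [h]: whatever is shifted past the end is lost, hence
    nilpotency. *)
Definition shift_mx (R : pzSemiRingType) (h s : nat) : 'M[R]_h :=
  \matrix_(i, j) (j == (i + s)%N :> nat)%:R.

Lemma sum_delta_nat (R : pzSemiRingType) (h a : nat) (F : nat -> R) :
  \sum_(j < h) (j == a :> nat)%:R * F j = if (a < h)%N then F a else 0.
Proof.
case: ltnP => [lt_ah | le_ha].
  rewrite (bigD1 (Ordinal lt_ah)) //= eqxx mul1r big1 ?addr0 // => j.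
  by rewrite -val_eqE /= => /negPf ->; rewrite mul0r.
rewrite big1 // => j _; rewrite (ltn_eqF (leq_trans (ltn_ord j) le_ha)).
by rewrite mul0r.
Qed.

Lemma shift_mxX (R : pzSemiRingType) (h s k : nat) :
  shift_mx R h s ^+ k = shift_mx R h (k * s).
Proof.
elim: k => [|k IHk].
  by apply/matrixP => i j; rewrite !mxE mul0n addn0 -val_eqE eq_sym.
rewrite exprSr IHk -mulmxE; apply/matrixP => i j; rewrite !mxE.
under eq_bigr => l _ do rewrite !mxE.
rewrite (sum_delta_nat _ _ (fun l => (j == (l + s)%N :> nat)%:R)) mulSn.
(* If the intermediate index already exceeds the range, so does the final one, and both entries are
   0. *)
rewrite [(s + _)%N]addnC addnA; case: ltnP => // le_h.
by rewrite (ltn_eqF (leq_trans (ltn_ord j) (leq_trans le_h (leq_addr _ _)))).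
Qed.

Lemma shift_mx0 (R : pzSemiRingType) (h s : nat) :
  (h <= s)%N -> shift_mx R h s = 0.
Proof.
move=> le_hs; apply/matrixP => i j; rewrite !mxE.
by rewrite (ltn_eqF (leq_trans (ltn_ord j) (leq_trans le_hs (leq_addl _ _)))).
Qed.

(* Blocks have size d.+1 rather than d, so that there is a hidden unit and the
   shift is nilpotent even when d = 0; the last column of each block is unused. *)
Section BlockReadout.
Variables (R : comPzRingType) (K d : nat) (theta : 'I_K.+1 -> R).

Definition embed_mx : 'M[R]_(d, K.+1 * d.+1) :=
  \matrix_(i, j) (j == i :> nat)%:R.

Definition readout_mx : 'M[R]_(K.+1 * d.+1, d) :=
  \matrix_(j, l) (theta (inord (j %/ d.+1)) *+ (j %% d.+1 == l)%N).

Lemma embed_shift_readout (k : 'I_K.+1) :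
  embed_mx *m shift_mx R (K.+1 * d.+1) d.+1 ^+ k *m readout_mx = (theta k)%:M.
Proof.
have lt_h (i : 'I_d) : (i + k * d.+1 < K.+1 * d.+1)%N.
  apply: (@leq_trans (k.+1 * d.+1)); last by rewrite leq_pmul2r.
  by rewrite mulSn ltn_add2r ltnS ltnW.
have -> : embed_mx *m shift_mx R (K.+1 * d.+1) d.+1 ^+ k =
          \matrix_(i, j) (j == (i + k * d.+1)%N :> nat)%:R.
  rewrite shift_mxX; apply/matrixP => i j; rewrite !mxE.
  under eq_bigr => l _ do rewrite !mxE.
  rewrite (sum_delta_nat _ _ (fun l => (j == (l + k * d.+1)%N :> nat)%:R)).
  by rewrite (leq_ltn_trans (leq_addr _ _) (lt_h i)).
apply/matrixP => i l; rewrite !mxE.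
under eq_bigr => j _ do rewrite !mxE.
rewrite (sum_delta_nat _ _
  (fun j => theta (inord (j %/ d.+1)) *+ (j %% d.+1 == l)%N)) lt_h.
(* Dividing [i + k * d.+1] by [d.+1] recovers block [k] and position [i]. *)
have lt_id : (i < d.+1)%N by rewrite ltnS ltnW.
by rewrite addnC divnMDl // modnMDl divn_small // modn_small // addn0 inord_val.
Qed.

End BlockReadout.

Theorem theorem4p7 (R : realType) (n m : nat) (G : hypergraph R n m)
    (hG : admissible G) (K d : nat) (theta : 'I_K.+1 -> R) :
  exists N : ihgnn R d d,
    activation N =1 id /\
    ihgnn_expresses G N (polynomial_filter (normalized_laplacian G) theta).
Proof.
have h_gt0 : (0 < K.+1 * d.+1)%N by [].
set S := shift_mx R (K.+1 * d.+1) d.+1.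
exists (IHGNN id h_gt0 S (embed_mx R K d) (readout_mx d theta) 0).
split=> // X; set M := normalized_laplacian G.
(* The total shift [K.+1 * d.+1] is exactly the hidden dimension. *)
have S0 : S ^+ K.+1 = 0 by rewrite shift_mxX shift_mx0.
pose Z := \sum_(k < K.+1) M ^+ k *m (X *m embed_mx R K d) *m S ^+ k.
have eq_solution Z' : Z' = map_mx id (M *m Z' *m S + X *m embed_mx R K d
    + (const_mx 1 : 'cV[R]_n) *m (0 : 'cV[R]_(K.+1 * d.+1))^T) <-> Z' = Z.
  by rewrite map_mx_id // trmx0 mulmx0 addr0; apply: stein_nilpotent.
exists Z; split; first by split=> [|Z' /eq_solution ->//]; apply/eq_solution.
rewrite /polynomial_filter !mulmx_suml; apply: eq_bigr => k _ /=.
by rewrite -!mulmxA [embed_mx R K d *m _]mulmxA embed_shift_readout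
  mul_mx_scalar -scalemxAr scalemxAl.
Qed.
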